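(* Let $G$ be a $d$-regular graph, let $c$ be a proper $k$-coloring of $G$, and let $B_c$ be the set of all bad vertices of $G$ for the coloring $c$. Then $$\chi_2(G)\leq k+2\,\chi\big(G^2[B_c]\setminus E(G)\big).$$ Therefore, $$\chi_2(G)\leq \min\big\{k+2\,\chi\big(G^2[B_c]\setminus E(G)\big) : c \text{ is a proper } k\text{-coloring of } G\big\},$$ where the minimum is over all $k$ and all proper $k$-colorings $c$ of $G$.
   Context: Graphs are finite and simple. $\chi$ denotes the chromatic number (the graph with no vertices has chromatic number $0$). A dynamic ($2$-dynamic) $k$-coloring of $G$ is a proper vertex coloring of $G$ with $k$ colors such that, for every vertex $v$, at least $\min\{2,\deg(v)\}$ different colors appear on the neighbors of $v$; $\chi_2(G)$ is the smallest $k$ such that $G$ has a dynamic $k$-coloring. For a $k$-coloring $c$ of $G$, a vertex $v$ is bad if $\deg(v)\geq 2$ and only one color appears on the neighbors of $v$; $B_c$ denotes the set of all bad vertices for $c$. The second power $G^2$ of $G$ is the graph with vertex set $V(G)$ in which two distinct vertices are adjacent if and only if their distance in $G$ is at most $2$. $G^2[B_c]$ is the subgraph of $G^2$ induced on $B_c$, and $G^2[B_c]\setminus E(G)$ is the graph on vertex set $B_c$ obtained from $G^2[B_c]$ by deleting all edges that are edges of $G$. *)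

(* Defs.v *)
From mathcomp Require Import all_boot.
Set Implicit Arguments.
Unset Strict Implicit.
Unset Printing Implicit Defensive.

Record sgraph (T : finType) := SGraph {
  adj : rel T;
  adj_sym : symmetric adj;
  adj_irrefl : irreflexive adj }.

Section Graphs.
Variable T : finType.
Implicit Types (G H : sgraph T) (x y v : T).

Definition nbhd G v : {set T} := [set u | adj G v u].

Definition deg G v : nat := #|nbhd G v|.

Definition regular (d : nat) G : Prop := forall v, deg G v = d.

Definition walk G (n : nat) x y : bool :=
  [exists p : n.-tuple T, path (adj G) x p && (last x p == y)].

(* x and y are at finite distance n; no n satisfies this when x and y lie in
   different components. *)
Definition is_dist G x y (n : nat) : bool :=
  walk G n x y && [forall m : 'I_n, ~~ walk G m x y].

Lemma walk_sym G n x y : walk G n x y = walk G n y x.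
Proof.
have sub a b : walk G n a b -> walk G n b a.
  case/existsP=> p /andP[pp /eqP <-].
  have sz : size (rev (belast a p)) == n by rewrite size_rev size_belast size_tuple.
  apply/existsP; exists (Tuple sz) => /=; apply/andP; split.
    by rewrite rev_path (eq_path (e' := adj G)) // => u v; exact: adj_sym.
  by case: (tval p) => [|u s] //=; rewrite rev_cons last_rcons.
by apply/idP/idP; exact: sub.
Qed.

Lemma is_dist_sym G x y n : is_dist G x y n = is_dist G y x n.
Proof.
rewrite /is_dist walk_sym; congr andb.
by apply: eq_forallb => m; rewrite walk_sym.
Qed.

Definition square_adj G : rel T :=
  [rel x y | (x != y) && [exists n : 'I_3, is_dist G x y n]].

Lemma square_sym G : symmetric (square_adj G).
Proof.
move=> x y; rewrite /square_adj /= (eq_sym x); congr andb.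
by apply: eq_existsb => n; exact: is_dist_sym.
Qed.

Lemma square_irrefl G : irreflexive (square_adj G).
Proof. by move=> x; rewrite /square_adj /= eqxx. Qed.

Definition square G : sgraph T := SGraph (@square_sym G) (@square_irrefl G).

Definition induced_adj G (B : {set T}) : rel {x : T | x \in B} :=
  [rel u v | adj G (val u) (val v)].

Lemma induced_sym G B : symmetric (@induced_adj G B).
Proof. by move=> u v; exact: adj_sym. Qed.

Lemma induced_irrefl G B : irreflexive (@induced_adj G B).
Proof. by move=> u; exact: adj_irrefl. Qed.

Definition induced G (B : {set T}) : sgraph {x : T | x \in B} :=
  SGraph (@induced_sym G B) (@induced_irrefl G B).

Definition del_edges_adj G H : rel T := [rel x y | adj G x y && ~~ adj H x y].

Lemma del_edges_sym G H : symmetric (del_edges_adj G H).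
Proof. by move=> x y; rewrite /del_edges_adj /= !(adj_sym _ x). Qed.

Lemma del_edges_irrefl G H : irreflexive (del_edges_adj G H).
Proof. by move=> x; rewrite /del_edges_adj /= adj_irrefl. Qed.

Definition del_edges G H : sgraph T :=
  SGraph (@del_edges_sym G H) (@del_edges_irrefl G H).

Definition proper_coloring G k (c : {ffun T -> 'I_k}) : bool :=
  [forall x, forall y, adj G x y ==> (c x != c y)].

Definition nbhd_colors G k (c : {ffun T -> 'I_k}) v : {set 'I_k} :=
  c @: nbhd G v.

Definition dynamic_coloring G k (c : {ffun T -> 'I_k}) : bool :=
  proper_coloring G c && [forall v, minn 2 (deg G v) <= #|nbhd_colors G c v|].

Definition bad_set G k (c : {ffun T -> 'I_k}) : {set T} :=
  [set v | (2 <= deg G v) && (#|nbhd_colors G c v| == 1)].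

Lemma dynamic_ex G : exists k, [exists c : {ffun T -> 'I_k}, dynamic_coloring G c].
Proof.
exists #|T|; apply/existsP; exists [ffun x => enum_rank x].
apply/andP; split.
  apply/forallP=> x; apply/forallP=> y; apply/implyP; rewrite !ffunE.
  by apply: contraTneq => /enum_rank_inj->; rewrite adj_irrefl.
apply/forallP=> v; rewrite card_imset ?geq_minr // => x y.
by rewrite !ffunE => /enum_rank_inj.
Qed.

Lemma proper_ex G : exists k, [exists c : {ffun T -> 'I_k}, proper_coloring G c].
Proof.
have [k /existsP[c /andP[pc _]]] := dynamic_ex G.
by exists k; apply/existsP; exists c.
Qed.

Definition chi G : nat := ex_minn (proper_ex G).

Definition chi2 G : nat := ex_minn (dynamic_ex G).

End Graphs.

Definition bad_graph (T : finType) (G : sgraph T) k (c : {ffun T -> 'I_k}) :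
    sgraph {x : T | x \in bad_set G c} :=
  del_edges (induced (square G) (bad_set G c)) (induced G (bad_set G c)).

Definition is_min (P : nat -> Prop) (m : nat) : Prop :=
  P m /\ forall n, P n -> m <= n.

(* Main.v *)
Require Import Defs.
From mathcomp Require Import all_boot zify.

(** Two bad vertices in the same color class of [bad_graph G c] have no common
    neighbor.  For such a class [S], give one neighbor of each vertex of [S] one
    of two new colors.  Haxell's theorem makes this possible: it is applied to
    two disjoint copies of a conflict graph on the vertices of N(S) outside [S],
    the part of [v] being the two copies of N(v) minus [S].  At most one
    neighbor of [v] lies in [S], so parts have size at least 2(d-1), while every
    vertex loses its neighbor in [S] and so has at most d-1 conflicts.  The new
    coloring is proper, no vertex of [S] is bad and no new vertex becomes bad;
    iterate over the classes.

    Haxell's theorem: a partial transversal [t] missing one class is modified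
    along a list of vertices [xs], each adjacent to some [t j] but to none of
    the earlier [xs] or of their [t]-neighbors.  If [t] cannot be improved, then
    [xs] and its [t]-neighbors, at most 2(m-1) vertices, dominate m classes. *)

Set Implicit Arguments.
Unset Strict Implicit.
Unset Printing Implicit Defensive.

(** * Independent transversals *)

Section IndependentTransversal.
Variables (V I : finType) (r : rel V) (D : nat) (P : I -> {set V}).
Hypothesis r_sym : symmetric r.
Hypothesis D_gt0 : 0 < D.
Hypothesis r_deg : forall x, #|[set y | r x y]| <= D.

Definition ind_transversal (J : {set I}) (t : I -> V) : Prop :=
  {in J, forall i, t i \in P i} /\
  {in J &, forall i j, i != j -> ~~ r (t i) (t j)}.

(** * Extending a partial transversal by one class *)

Section AddClass.
Variables (J : {set I}) (a : I).
Hypothesis aJ : a \notin J.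
Hypothesis P_large : {in a |: J, forall i, 2 * D <= #|P i|}.
Hypothesis P_disj :
  forall x, {in a |: J &, forall i j, x \in P i -> x \in P j -> i = j}.

Definition hits (t : I -> V) (x : V) : {set I} := [set j in J | r x (t j)].

Definition hits_seq t (xs : seq V) : {set I} := \bigcup_(x <- xs) hits t x.

(** Freezes everything that the choice of the next list entry depends on, so that a vertex
    undominated for [t] stays so for [t']. *)
Definition agree t' t xs : Prop :=
  {in xs, forall x, hits t' x = hits t x} /\
  {in hits_seq t xs, forall j, t' j = t j}.

(* Lexicographic decrease of the cardinals of [hits], the last element of the
   list being compared first. *)
Fixpoint improves t' t (xs : seq V) : Prop :=
  if xs is x :: xs' then
    improves t' t xs' \/
    (agree t' t xs' /\ #|hits t' x| < #|hits t x|)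
  else False.

Definition undominated t xs x : Prop :=
  {in xs, forall y, ~~ r x y} /\ {in hits_seq t xs, forall j, ~~ r x (t j)}.

Lemma hits_seqP t xs j :
  reflect (exists2 x, x \in xs & j \in hits t x) (j \in hits_seq t xs).
Proof.
rewrite /hits_seq; elim: xs => [|x xs IH].
  by rewrite big_nil inE; constructor=> -[].
rewrite big_cons inE; apply: (iffP orP) => [[jx|/IH[y yxs jy]]|[y]].
- by exists x => //; rewrite mem_head.
- by exists y => //; rewrite inE yxs orbT.
- by rewrite inE => /predU1P[->|yxs jy]; [left|right; apply/IH; exists y].
Qed.

Lemma hits_seq_sub t xs : hits_seq t xs \subset J.
Proof. by apply/subsetP=> j /hits_seqP[x _]; rewrite inE => /andP[]. Qed.

Lemma agree_hits_seq t' t xs :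
  agree t' t xs -> hits_seq t' xs = hits_seq t xs.
Proof.
case=> h _; apply/setP=> j.
by apply/hits_seqP/hits_seqP=> -[x xs_x jx]; exists x; rewrite ?h // -?h.
Qed.

Lemma agree_tail t' t x xs : agree t' t (x :: xs) -> agree t' t xs.
Proof.
case=> h1 h2; split=> [y yxs|j /hits_seqP[y yxs jy]].
  by apply: h1; rewrite inE yxs orbT.
by apply: h2; apply/hits_seqP; exists y; rewrite // inE yxs orbT.
Qed.

Lemma agree_trans t2 t1 t3 xs :
  agree t3 t2 xs -> agree t2 t1 xs -> agree t3 t1 xs.
Proof.
move=> a32 a21; have eqC := agree_hits_seq a21.
case: a32 a21 => [h1 h2] [g1 g2]; split=> [x xxs|j jC].
  by rewrite h1 // g1.
by rewrite h2 ?eqC // g2.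
Qed.

Lemma improves_agree t2 t1 t3 xs :
  improves t3 t2 xs -> agree t2 t1 xs -> improves t3 t1 xs.
Proof.
elim: xs => //= x xs IH [i32|[a32 lt32]] a21; have a21' := agree_tail a21.
  by left; apply: IH.
right; split; first exact: agree_trans a32 a21'.
by case: a21 => /(_ x (mem_head _ _)) <-.
Qed.

Lemma undominated_agree t' t xs x :
  agree t' t xs -> undominated t xs x -> undominated t' xs x.
Proof.
move=> ag [u1 u2]; split=> // j; rewrite (agree_hits_seq ag) => jC.
by case: ag => _ ->; rewrite // u2.
Qed.

(** With [C] the set of classes hit, the disjoint parts over [a |: C] have at least 2D(|C|+1)
    elements, while [xs] and the representatives of [C] have at most D(|xs|+|C|) <= 2D|C|
    neighbors. *)
Lemma exists_undominated t xs :
  size xs <= #|hits_seq t xs| ->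
  exists i x, [/\ i \in a |: hits_seq t xs, x \in P i & undominated t xs x].
Proof.
move=> le_xs; set C := hits_seq t xs.
have CJ : a |: C \subset a |: J by rewrite setUS ?hits_seq_sub.
have aC : a \notin C by apply: contra aJ; apply/subsetP/hits_seq_sub.
pose U := \bigcup_(i in a |: C) P i.
have leU : 2 * D * #|C|.+1 <= #|U|.
  have -> : #|U| = \sum_(i in a |: C) #|P i|.
    pose F x := \sum_(i in a |: C) (x \in P i).
    have FE x : F x = (x \in U).
      rewrite /F; case: bigcupP => [[i iC xi]|nx].
        rewrite (bigD1 i) //= xi big1 // => j /andP[jC ji].
        case: (boolP (x \in P j)) => // xj; case/eqP: ji.
        exact: (P_disj (subsetP CJ j jC) (subsetP CJ i iC) xj xi).
      rewrite big1 // => i iC.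
      by case: (boolP (x \in P i)) => // xi; case: nx; exists i.
    rewrite -sum1_card big_mkcond (eq_bigr F) => [|x _].
      rewrite exchange_big /=; apply: eq_bigr => i _.
      by rewrite -sum1_card [RHS]big_mkcond.
    by rewrite FE; case: (x \in U).
  have -> : #|C|.+1 = #|a |: C| by rewrite cardsU1 aC.
  rewrite mulnC -sum_nat_const; apply: leq_sum => i iC.
  by apply: P_large; apply: (subsetP CJ).
pose N x := [set y | r x y].
pose X1 := \bigcup_(x <- xs) N x; pose X2 := \bigcup_(j in C) N (t j).
have le1 : #|X1| <= D * size xs.
  rewrite /X1; elim: (xs) => [|x s IH]; first by rewrite big_nil cards0.
  rewrite big_cons (leq_trans (leq_card_setU _ _).1) //= mulnS leq_add //.
  exact: r_deg.
have le2 : #|X2| <= #|C| * D.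
  apply: (leq_trans (n := \sum_(j in C) #|N (t j)|)).
    rewrite /X2; elim/big_rec2: _ => [|j n X _ le]; first by rewrite cards0.
    by rewrite (leq_trans (leq_card_setU _ _).1) // leq_add2l.
  by rewrite -sum_nat_const leq_sum // => j _; apply: r_deg.
have lt : #|X1 :|: X2| < #|U|.
  apply: leq_ltn_trans (leq_card_setU _ _).1 _.
  by have : D * size xs <= D * #|C| by [rewrite leq_mul2l le_xs orbT]; nia.
have [x xU] : exists2 x, x \in U & x \notin X1 :|: X2.
  apply/subsetPn; apply: contraTN lt => /subset_leq_card.
  by rewrite -leqNgt.
rewrite inE negb_or => /andP[x1 x2].
case/bigcupP: xU => i iC xi; exists i, x; split=> //; split=> [y yxs|j jC].
  apply: contra x1 => rxy; rewrite /X1 (big_rem y) //= inE.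
  by rewrite inE r_sym rxy.
by apply: contra x2 => rxy; apply/bigcupP; exists j; rewrite // inE r_sym.
Qed.

(** The gain occurs at the oldest entry of [xs] that hits [i]: it is not adjacent to [x], so it
    loses [i], and older entries see no change. *)
Lemma swap_improves t xs x i :
  undominated t xs x -> hits t x = set0 -> i \in hits_seq t xs ->
  improves (fun j => if j == i then x else t j) t xs.
Proof.
move=> [u1 _] hx; set t' := fun j => _.
elim: xs u1 => [|y xs IH] u1 /=; first by rewrite /hits_seq big_nil inE.
have u1' : {in xs, forall y, ~~ r x y}.
  by move=> z zxs; apply: u1; rewrite inE zxs orbT.
have [iC _|iC] := boolP (i \in hits_seq t xs); first by left; apply: IH.
rewrite /hits_seq big_cons inE -/(hits_seq _ _) (negPf iC) orbF => iy.
right; split.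
  split=> [z zxs|j jC].
    apply/setP=> j; rewrite !inE /t'; case: eqP => // ->.
    case: (boolP (i \in J)) => //= iJ.
    rewrite r_sym (negPf (u1' z zxs)); symmetry; apply/negbTE.
    by apply: contra iC => rz; apply/hits_seqP; exists z; rewrite // inE iJ.
  by rewrite /t'; case: eqP => // ji; rewrite -ji jC in iC.
apply: proper_card; apply/properP; split.
  apply/subsetP=> j; rewrite !inE /t'; case: eqP => // ->.
  by rewrite r_sym (negPf (u1 y (mem_head _ _))) andbF.
by exists i; rewrite // inE /t' eqxx r_sym (negPf (u1 y (mem_head _ _))) andbF.
Qed.

Lemma swap_transversal t x i :
  ind_transversal J t -> hits t x = set0 -> x \in P i ->
  ind_transversal (i |: J) (fun j => if j == i then x else t j).
Proof.
move=> [tP tI] hx xi.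
have nr j : j \in J -> ~~ r x (t j).
  by move=> jJ; move/setP/(_ j): hx; rewrite !inE jJ /= => ->.
split=> [j|j l]; rewrite !inE.
  by case: eqP => [->|_ /= jJ] //; apply: tP.
case: (eqVneq j i) => [->|ji]; case: (eqVneq l i) => [->|li] //=.
- by move=> _ lJ _; apply: nr.
- by move=> jJ _ _; rewrite r_sym nr.
- exact: tI.
Qed.

Lemma transversal_sub (J1 J2 : {set I}) t :
  J1 \subset J2 -> ind_transversal J2 t -> ind_transversal J1 t.
Proof.
move/subsetP=> sJ [t1 t2].
by split=> [i /sJ|i j /sJ iJ /sJ]; [apply: t1|apply: t2].
Qed.

(** Two nested inductions. The outer one, on [n], measures the room left for [xs], which cannot
    outgrow the number of classes it hits. The inner one is on the number of hits of the vertex [x]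
    about to be added. *)
Lemma improve_or_extend n t xs :
  #|I| < n + size xs -> size xs <= #|hits_seq t xs| -> ind_transversal J t ->
  (exists t', ind_transversal (a |: J) t') \/
  (exists2 t', ind_transversal J t' & improves t' t xs).
Proof.
elim: n t xs => [|n IHn] t xs lt_n le_xs tJ.
  by have := leq_trans le_xs (max_card _); rewrite leqNgt lt_n.
have [i [x [iC xi ux]]] := exists_undominated le_xs.
(* Here [x] stays fixed while the transversal changes. *)
suff H m t1 : #|hits t1 x| < m -> ind_transversal J t1 -> agree t1 t xs ->
    (exists t', ind_transversal (a |: J) t') \/
    (exists2 t', ind_transversal J t' & improves t' t1 xs).
  by apply: (H _ t (leqnn _)) => //; split.
elim: m t1 => // m IHm t1 lt_m t1J ag.
have ux1 := undominated_agree ag ux.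
have [hx0|hxN0] := eqVneq (hits t1 x) set0.
  have swJ := swap_transversal t1J hx0 xi.
  move: iC; rewrite -(agree_hits_seq ag) => /setU1P[ia|iC].
    by left; rewrite -ia; eexists; apply: swJ.
  right; eexists; last exact: swap_improves ux1 hx0 iC.
  exact: transversal_sub (subsetUr _ _) swJ.
(* As [x] is undominated, it hits no class already hit, and it hits at least one. *)
have le_xxs : size (x :: xs) <= #|hits_seq t1 (x :: xs)|.
  rewrite /hits_seq big_cons -/(hits_seq _ _) cardsU.
  have -> : hits t1 x :&: hits_seq t1 xs = set0.
    apply/setP=> j; rewrite !inE; apply/negP=> /andP[/andP[_ rj] jC].
    by case: ux1 => _ /(_ j jC); rewrite rj.
  rewrite cards0 subn0 (agree_hits_seq ag) /= -add1n leq_add //.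
  by rewrite card_gt0.
have [||[t2 t2J [im|[ag2 lt2]]]] := IHn t1 (x :: xs) _ le_xxs t1J.
- by rewrite /= addnS.
- by left.
- by right; exists t2.
(* Nothing changed on [xs], but [x] has fewer hits: retry with the same [x]. *)
have [||[t3 t3J im3]] := IHm t2 _ t2J (agree_trans ag2 ag).
- exact: leq_trans lt2 _.
- by left.
- by right; exists t3 => //; apply: improves_agree im3 ag2.
Qed.

Lemma transversal_add t :
  ind_transversal J t -> exists t', ind_transversal (a |: J) t'.
Proof.
(* The empty list admits no improvement, which leaves only the extension. *)
move=> tJ; have [||//|[t' _ []]] := @improve_or_extend #|I|.+1 t [::] _ _ tJ.
  by rewrite addn0.
by [].
Qed.

End AddClass.

Theorem haxell (J : {set I}) (t0 : I -> V) :
  {in J, forall i, 2 * D <= #|P i|} ->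
  (forall x, {in J &, forall i j, x \in P i -> x \in P j -> i = j}) ->
  exists t, ind_transversal J t.
Proof.
have [n] := ubnP #|J|; elim: n J => // n IH J; rewrite ltnS => leJ PJ disj.
have [->|[a aJ]] := set_0Vmem J.
  by exists t0; split=> i; rewrite inE.
rewrite -(setD1K aJ) in PJ disj *.
have sub i : i \in J :\ a -> i \in a |: (J :\ a) by apply: setU1r.
have [||x i j iJ jJ|t tJ] := IH (J :\ a).
- by move: leJ; rewrite (cardsD1 a) aJ.
- by move=> i /sub; apply: PJ.
- by apply: disj; apply: sub.
by apply: transversal_add tJ => //; rewrite !inE eqxx.
Qed.

End IndependentTransversal.

(** * Recoloring *)

Section Recoloring.
Variables (T : finType) (G : sgraph T).

Definition no_common_nbr (S : {set T}) : Prop :=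
  {in S &, forall u v x, adj G u x -> adj G v x -> u = v}.

(** Colors range over any finite type, so that two new ones can be added by passing from [C] to
    [C + bool]. *)
Definition proper_fun (C : finType) (f : T -> C) : Prop :=
  forall x y, adj G x y -> f x != f y.

Definition bad (C : finType) (f : T -> C) (v : T) : Prop :=
  1 < deg G v /\ {in nbhd G v &, forall x y, f x = f y}.

(** * Conflicts among the candidates for recoloring *)

Section Conflict.
Variables (d : nat) (S : {set T}) (nbr1 nbr2 : T -> T).
Hypothesis regG : regular d G.
Hypothesis d_gt1 : 1 < d.
Hypothesis nccS : no_common_nbr S.
Hypothesis nbr1P : forall w, adj G w (nbr1 w).
Hypothesis nbr2P : forall w, adj G w (nbr2 w).
Hypothesis nbr12 : forall w, nbr1 w != nbr2 w.

Definition nbhdS : {set T} := [set x | [exists v in S, adj G v x]].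

(* Each [w] outside [S :|: nbhdS] contributes a conflict between two of its
   neighbors, so that its neighborhood cannot become monochromatic.  This does
   not raise degrees: such a [w] is itself not a vertex of the conflict graph. *)
Definition conflict : rel T := [rel x y |
  [&& x \in nbhdS :\: S, y \in nbhdS :\: S &
   adj G x y || [exists w, (w \notin S :|: nbhdS) &&
     ((x == nbr1 w) && (y == nbr2 w) || (x == nbr2 w) && (y == nbr1 w))]]].

Lemma conflict_sym : symmetric conflict.
Proof.
move=> x y; rewrite /conflict /= andbCA; do 2!congr andb.
rewrite adj_sym; congr orb; apply: eq_existsb => w; congr andb.
by rewrite orbC ![(x == _) && _]andbC.
Qed.

(** The image under [phi] of the neighbors of [x] outside [S] contains all conflicts of [x]: a
    neighbor in [nbhdS] stands for itself, any other for the partner of [x] in its chosen pair. As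
    [x] lies in [nbhdS], one of its d neighbors is in [S]. *)
Lemma conflict_deg x : #|[set y | conflict x y]| <= d.-1.
Proof.
have [xU|xU] := boolP (x \in nbhdS :\: S); last first.
  rewrite (_ : [set y | _] = set0) ?cards0 //.
  by apply/setP=> y; rewrite !inE /conflict /= (negPf xU).
pose phi z := if z \in nbhdS then z else if x == nbr1 z then nbr2 z else nbr1 z.
have le : #|nbhd G x :\: S| <= d.-1.
  have := xU; rewrite !inE => /andP[_ /existsP[v /andP[vS avx]]].
  rewrite -(regG x) /deg [in X in _ <= X](cardsD1 v) inE adj_sym avx /=.
  apply: subset_leq_card; apply/subsetP=> y; rewrite !inE => /andP[yS ->].
  by rewrite andbT; apply: contra yS => /eqP->.
apply: leq_trans le; apply: leq_trans (leq_imset_card phi _).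
apply: subset_leq_card; apply/subsetP=> y; rewrite inE /conflict /=.
case/and3P=> _ yU /orP[axy|/existsP[w /andP[wS xy]]].
  move: yU; rewrite inE => /andP[yS yN].
  by apply/imsetP; exists y; rewrite ?inE ?yS // /phi yN.
move: wS; rewrite in_setU negb_or => /andP[wS wN].
apply/imsetP; exists w.
  by rewrite !inE wS adj_sym; case/orP: xy => /andP[/eqP-> _]; rewrite ?nbr1P ?nbr2P.
rewrite /phi (negPf wN); case/orP: xy => /andP[/eqP-> /eqP->].
  by rewrite eqxx.
by rewrite eq_sym (negPf (nbr12 w)).
Qed.

(** The Boolean is both the index of the copy and the new color. Edges of the doubled graph stay
    inside a copy, so conflicting representatives must come from different copies. *)
Lemma conflict_transversal : exists t : T -> T * bool,
  {in S, forall v, adj G v (t v).1 /\ (t v).1 \notin S} /\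
  {in S &, forall u v, u != v -> conflict (t u).1 (t v).1 -> (t u).2 != (t v).2}.
Proof.
pose P v := [set z : T * bool | z.1 \in nbhd G v :\: S].
pose r := [rel z1 z2 : T * bool | conflict z1.1 z2.1 && (z1.2 == z2.2)].
have [|||||t [tP tI]] := @haxell _ _ r d.-1 P _ _ _ S (fun v => (v, true)).
- by move=> x y; rewrite /r /= conflict_sym eq_sym.
- by rewrite -ltnS prednK // ltnW.
- move=> [x b]; apply: leq_trans (conflict_deg x).
  rewrite -[leqRHS](card_imset _ (f := fun y => (y, b))); last by move=> ? ? [].
  apply: subset_leq_card; apply/subsetP=> -[y b']; rewrite !inE /=.
  by case/andP=> xy /eqP->; apply: imset_f; rewrite inE.
- move=> v vS; have -> : P v = setX (nbhd G v :\: S) [set: bool].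
    by apply/setP=> -[y b]; rewrite !inE andbT.
  rewrite cardsX cardsT card_bool mulnC leq_mul2r /=.
  rewrite cardsD -/(deg G v) regG -subn1 leq_sub2l //.
  (* Two neighbors of [v] in [S] would have [v] as a common neighbor. *)
  apply/card_le1_eqP=> x y; rewrite !inE => /andP[vx xS] /andP[vy yS].
  by apply: (@nccS y x yS xS v); rewrite adj_sym.
- move=> z u v uS vS; rewrite !inE => /andP[_ uz] /andP[_ vz].
  exact: nccS uz vz.
- exists t; split=> [v /tP|u v uS vS uv]; first by rewrite !inE => /andP[].
  by have := tI u v uS vS uv; rewrite /r /= negb_and => /orP[/negP|].
Qed.

End Conflict.

(** * Recoloring class by class *)

Lemma recolor_step d (S : {set T}) (C : finType) (f : T -> C) :
  regular d G -> 1 < d -> no_common_nbr S -> proper_fun f ->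
  exists f' : T -> C + bool,
    proper_fun f' /\ forall v, bad f' v -> bad f v /\ v \notin S.
Proof.
move=> regG d1 nccS pf.
have /fin_all_exists[nb nbP] w :
    exists p, [/\ adj G w p.1, adj G w p.2 & p.1 != p.2].
  have := d1; rewrite -(regG w) => /card_gt1P[x [y []]].
  by rewrite !inE => wx wy xy; exists (x, y).
pose nbr1 w := (nb w).1; pose nbr2 w := (nb w).2.
have nb1 w : adj G w (nbr1 w) by case: (nbP w).
have nb2 w : adj G w (nbr2 w) by case: (nbP w).
have nb12 w : nbr1 w != nbr2 w by case: (nbP w).
have [t [tP tI]] := conflict_transversal regG d1 nccS nb1 nb2 nb12.
have tU v : v \in S -> (t v).1 \in nbhdS S :\: S.
  by move=> vS; have [avt tS] := tP v vS; rewrite !inE tS; apply/existsP; exists v; rewrite vS.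
(* A representative has a unique neighbor in [S], so [rec] recovers the vertex it was chosen for. *)
pose rec x := [pick v in S | (t v).1 == x].
pose f' x : C + bool := if rec x is Some v then inr (t v).2 else inl (f x).
have recP x v : v \in S -> (t v).1 = x -> rec x = Some v.
  move=> vS tvx; rewrite /rec; case: pickP => [u /andP[uS /eqP tux]|/(_ v)].
    congr Some; apply: (@nccS _ _ uS vS x); [rewrite -tux|rewrite -tvx].
      by case: (tP u uS).
    by case: (tP v vS).
  by rewrite vS tvx eqxx.
have f'P x : (exists v, [/\ v \in S, (t v).1 = x & f' x = inr (t v).2]) \/
             f' x = inl (f x).
  rewrite /f'; case E: (rec x) => [v|]; last by right.
  left; exists v; move: E; rewrite /rec.
  by case: pickP => // u /andP[uS /eqP tu] [<-].
have f'_conf u v : u \in S -> v \in S -> conflict S nbr1 nbr2 (t u).1 (t v).1 ->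
    (t u).1 != (t v).1 -> f' (t u).1 != f' (t v).1.
  move=> uS vS cf ne; rewrite /f' (recP _ u) // (recP _ v) //.
  have uv : u != v by apply: contraNneq ne => ->.
  by have := tI u v uS vS uv cf; apply: contraNneq => -[->].
exists f'; split.
  move=> x y axy.
  have [[u [uS tu fx]]|fx] := f'P x; have [[v [vS tv fy]]|fy] := f'P y.
  - rewrite -tu -tv; apply: f'_conf => //.
      by rewrite /conflict /= !tU // tu tv axy.
    by rewrite tu tv; apply: contraTneq axy => ->; rewrite adj_irrefl.
  - by rewrite fx fy.
  - by rewrite fx fy.
  - by rewrite fx fy; apply: contraNneq (pf x y axy) => -[->].
move=> w [dw mono].
have mono' x y : adj G w x -> adj G w y -> f' x = f' y.
  by move=> wx wy; apply: mono; rewrite inE.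
(* If [nbr1 w] has a new color, so do all neighbors of [w]. But recolored vertices avoid [S], and a
   vertex of [S] has only one recolored neighbor. So [w] is outside [S] and [nbhdS S], and its two
   chosen neighbors conflict, hence differ in color. *)
have [[u [uS tu fx]]|fx] := f'P (nbr1 w).
  have all_rec y : adj G w y -> exists2 v, v \in S & (t v).1 = y.
    move=> wy; have := mono' _ _ wy (nb1 w); rewrite fx.
    by have [[v [vS tv _]]|-> //] := f'P y; exists v.
  have wN : w \notin nbhdS S.
    apply/negP; rewrite inE => /existsP[v /andP[vS avw]].
    have [|s sS ts] := all_rec v; first by rewrite adj_sym.
    by have [_] := tP s sS; rewrite ts vS.
  have wS : w \notin S.
    apply/negP=> wS; have rw y : adj G w y -> y = (t w).1.
      move=> wy; have [v vS tv] := all_rec y wy.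
      rewrite -tv; congr (t _).1; apply: (@nccS v w vS wS y) => //.
      by rewrite -tv; case: (tP v vS).
    by have := nb12 w; rewrite (rw _ (nb1 w)) (rw _ (nb2 w)) eqxx.
  have [v vS tv] := all_rec _ (nb2 w).
  have := mono' _ _ (nb1 w) (nb2 w); rewrite -tu -tv => /eqP.
  rewrite (negPf (f'_conf u v uS vS _ _)) // ?tu ?tv //.
  rewrite /conflict /= -{1}tu -{1}tv !tU //=; apply/orP; right.
  by apply/existsP; exists w; rewrite in_setU negb_or wS wN !eqxx.
(* Otherwise all neighbors of [w] keep their old colors, so [w] was already bad; it is not in [S],
   where each vertex has a recolored neighbor. *)
have f'f y : adj G w y -> f' y = inl (f y).
  move=> wy; have := mono' _ _ wy (nb1 w); rewrite fx.
  by have [[v [_ _ ->]]|->] := f'P y.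
split.
  split=> // x y; rewrite !inE => wx wy.
  by have := mono' x y wx wy; rewrite !f'f // => -[].
apply/negP=> wS; have [wt _] := tP w wS; have := f'f _ wt.
by rewrite /f' (recP _ w).
Qed.

Lemma recolor d (Ss : seq {set T}) (C : finType) (f : T -> C) :
  regular d G -> 1 < d -> {in Ss, forall S, no_common_nbr S} -> proper_fun f ->
  exists (C' : finType) (f' : T -> C'),
    [/\ #|C'| = #|C| + 2 * size Ss, proper_fun f' &
        forall v, bad f' v -> bad f v /\ {in Ss, forall S : {set T}, v \notin S}].
Proof.
move=> regG d1; elim: Ss C f => [|S Ss IH] C f nccS pf.
  by exists C, f; split; rewrite //= ?muln0 ?addn0.
have [f1 [pf1 bad1]] :=
  recolor_step regG d1 (nccS S (mem_head _ _)) pf.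
have [S' S'Ss|C' [f' [cC' pf' bad']]] := IH _ f1 _ pf1.
  by apply: nccS; rewrite inE S'Ss orbT.
exists C', f'; split=> // [|v bv].
  by rewrite cC' card_sum card_bool /=; lia.
have [/bad1[bv' vS] vSs] := bad' v bv; split=> // S'.
by rewrite inE => /predU1P[->|/vSs].
Qed.

(** * Dynamic colorings, distance two and classes of bad vertices *)

Lemma chi2_le (C : finType) (f : T -> C) :
  proper_fun f -> (forall v, ~ bad f v) -> chi2 G <= #|C|.
Proof.
move=> pf nbad; rewrite /chi2; case: ex_minnP => m _; apply.
pose c := [ffun x => enum_rank (f x)].
apply/existsP; exists c; apply/andP; split.
  apply/forallP=> x; apply/forallP=> y; apply/implyP=> /pf.
  by rewrite !ffunE; apply: contraNneq => /enum_rank_inj->.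
apply/forallP=> v; rewrite leqNgt; apply/negP=> lt.
have [d1|d1] := ltnP 1 (deg G v).
  apply: (nbad v); split=> // x y xv yv; apply: enum_rank_inj.
  have le1 : #|nbhd_colors G c v| <= 1.
    by move: lt; rewrite (minn_idPl d1) ltnS.
  have := card_le1_eqP le1 (c x) (c y) (imset_f _ xv) (imset_f _ yv).
  by rewrite !ffunE.
(* In degree at most 1, a single color is enough as soon as there is a neighbor. *)
move: lt; rewrite (minn_idPr _); last exact: leqW.
rewrite ltnNge; case/negP.
have [nv0|[x xv]] := set_0Vmem (nbhd G v).
  by rewrite /deg nv0 cards0.
apply: leq_trans d1 _; rewrite card_gt0; apply/set0Pn; exists (c x).
exact: imset_f.
Qed.

Lemma bad_setP k (c : {ffun T -> 'I_k}) v : bad c v <-> v \in bad_set G c.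
Proof.
rewrite inE; split=> [[d1 mono]|/andP[d1 /cards1P[a ca]]].
  rewrite d1 /=; have [x [y [xv _ _]]] := card_gt1P d1.
  apply/cards1P; exists (c x); apply/setP=> z; rewrite inE.
  apply/imsetP/eqP=> [[u uv ->]|->]; first exact: mono.
  by exists x.
split=> // x y xv yv; have eqa z : z \in nbhd G v -> c z = a.
  by move=> zv; apply/set1P; rewrite -ca; apply: imset_f.
by rewrite !eqa.
Qed.

Lemma walk0 x y : walk G 0 x y = (x == y).
Proof.
apply/existsP/idP=> [[p]|/eqP->]; first by rewrite tuple0 /=.
by exists [tuple]; rewrite /= eqxx.
Qed.

Lemma walk1 x y : walk G 1 x y = adj G x y.
Proof.
apply/existsP/idP=> [[p]|axy].
  by case/tupleP: p => z p; rewrite tuple0 /= andbT => /andP[axz /eqP<-].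
by exists [tuple y]; rewrite /= axy eqxx.
Qed.

Lemma square_adj_common x y z :
  x != y -> ~~ adj G x y -> adj G x z -> adj G y z -> square_adj G x y.
Proof.
move=> xy nxy xz yz; rewrite /square_adj /= xy /=; apply/existsP.
exists (Ordinal (isT : 2 < 3)); apply/andP; split.
  by apply/existsP; exists [tuple z; y]; rewrite /= xz adj_sym yz eqxx.
by apply/forallP=> -[[|[|m]] //= ltm]; rewrite ?walk0 ?walk1.
Qed.

(** This is why edges of [G] may be deleted: if adjacent bad vertices u, v had a common neighbor x,
    then v and x, both neighbors of u, would share a color although adjacent. Distinct nonadjacent
    ones with a common neighbor are at distance 2, so [g] separates them. *)
Lemma bad_class_no_common_nbr k (c : {ffun T -> 'I_k}) r
    (g : {ffun {x : T | x \in bad_set G c} -> 'I_r}) i :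
  proper_coloring G c -> proper_coloring (bad_graph G c) g ->
  no_common_nbr [set val u | u in [set u | g u == i]].
Proof.
move=> pc pg u v /imsetP[u' gu ->] /imsetP[v' gv ->] x ux vx.
move: gu gv; rewrite !inE => /eqP gu /eqP gv.
apply/eqP; apply/negPn/negP=> uv.
have [auv|nuv] := boolP (adj G (val u') (val v')).
  have [_ mono] := (bad_setP c (val u')).2 (valP u').
  move/forallP/(_ (val v'))/forallP/(_ x)/implyP/(_ vx)/eqP: pc; apply.
  by apply: mono; rewrite inE.
have cf : adj (bad_graph G c) u' v'.
  by apply/andP; split; [apply: square_adj_common uv nuv ux vx | exact: nuv].
by move/forallP/(_ u')/forallP/(_ v')/implyP/(_ cf): pg; rewrite gu gv eqxx.
Qed.

Lemma chi2_le_bad_graph d k (c : {ffun T -> 'I_k}) :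
  regular d G -> proper_coloring G c -> chi2 G <= k + 2 * chi (bad_graph G c).
Proof.
move=> regG pc.
have pf : proper_fun c by move=> x y; move/forallP/(_ x)/forallP/(_ y)/implyP: pc.
have [d1|d1] := leqP d 1.
  (* For d at most 1 no vertex is bad, so [c] is already dynamic. *)
  rewrite (leq_trans _ (leq_addr _ _)) // -[X in _ <= X]card_ord.
  by apply: (chi2_le pf) => v []; rewrite regG ltnNge d1.
rewrite /chi; case: ex_minnP => r /existsP[g pg] _.
pose cls i := [set val u | u in [set u | g u == i]].
have [|C [f [cC pf' badf]]] :=
  @recolor d [seq cls i | i : 'I_r] _ c regG d1 _ pf.
  by move=> S /mapP[i _ ->]; apply: bad_class_no_common_nbr.
move: cC; rewrite size_map -cardE !card_ord => <-.
apply: (chi2_le pf') => v /badf[/bad_setP vB /(_ (cls (g (Sub v vB))))].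
have -> : v \in cls (g (Sub v vB)).
  by apply/imsetP; exists (Sub v vB); rewrite ?SubK // inE.
by move=> H; have /H : cls (g (Sub v vB)) \in [seq cls i | i : 'I_r]
  by apply: map_f; rewrite mem_enum.
Qed.

End Recoloring.

Theorem theorem2 (T : finType) (G : sgraph T) (d : nat) (hG : regular d G) :
  (forall (k : nat) (c : {ffun T -> 'I_k}), proper_coloring G c ->
     chi2 G <= k + 2 * chi (bad_graph G c)) /\
  (exists m : nat,
     is_min (fun n : nat => exists (k : nat) (c : {ffun T -> 'I_k}),
               proper_coloring G c /\ n = k + 2 * chi (bad_graph G c)) m /\
     chi2 G <= m).
Proof.
have bound k (c : {ffun T -> 'I_k}) := @chi2_le_bad_graph T G d k c hG.
split; first exact: bound.
(* Since k is at most n, it can range over a finite type; this makes the predicate Boolean, as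
   [ex_minnP] requires. *)
pose Q n := [exists k : 'I_n.+1, exists c : {ffun T -> 'I_k},
  proper_coloring G c && (n == k + 2 * chi (bad_graph G c))].
have QP n : reflect (exists (k : nat) (c : {ffun T -> 'I_k}),
    proper_coloring G c /\ n = k + 2 * chi (bad_graph G c)) (Q n).
  apply: (iffP existsP) => [[k /existsP[c /andP[pc /eqP nE]]]|[k [c [pc nE]]]].
    by exists k, c.
  have kn : k < n.+1 by rewrite nE ltnS leq_addr.
  by exists (Ordinal kn); apply/existsP; exists c; rewrite pc -nE eqxx.
have exQ : exists n, Q n.
  have [k /existsP[c pc]] := proper_ex G.
  by exists (k + 2 * chi (bad_graph G c)); apply/QP; exists k, c.
case: (ex_minnP exQ) => m /QP Qm minm; exists m; split.
  by split=> // n /QP /minm.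
by case: Qm => k [c [pc ->]]; apply: bound.
Qed.
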